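(* Let $N\ge 1$ be an integer and assume the prime $2N$-tuplets conjecture TC($2N$). Let $g$ be an integer with $g\ne -1$ and $g$ not a perfect square. Then there exist integers $A_1$ and $C_1$ such that $A_1n^2+C_1$ is prime for $n=1,\dots,N$ and $g$ is a primitive root modulo each of these primes.
   Context: TC($k$) is the statement: for all integers $A_1,\dots,A_k,B_1,\dots,B_k$ with $A_j>0$ such that for every prime $p$ there is an integer $n_p$ with $p\nmid\prod_{j=1}^k(A_jn_p+B_j)$, there exist infinitely many integers $n$ such that $A_jn+B_j$ is prime for all $1\le j\le k$. *)

(* Defs.v *)
From mathcomp Require Import all_boot all_order all_algebra.
From mathcomp Require Import all_classical.

Set Implicit Arguments.
Unset Strict Implicit.
Unset Printing Implicit Defensive.

Import Order.TTheory GRing.Theory Num.Theory.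

Local Open Scope ring_scope.
Local Open Scope classical_set_scope.

(* Primes are positive: the negative of a prime number does not count. *)
Definition primez (z : int) : bool := (0 < z) && prime `|z|%N.

Definition prime_tuplets_conjecture (k : nat) : Prop :=
  forall A B : 'I_k -> int,
    (forall j, 0 < A j) ->
    (forall p : nat, prime p ->
       exists n : int, ~~ (p%:Z %| \prod_(j < k) (A j * n + B j))%Z) ->
    infinite_set [set n : int | forall j : 'I_k, primez (A j * n + B j)].

(* The order of g in the multiplicative group of Z/pZ is p - 1. Only meaningful *)
(* when p is prime, since 'F_n is Z/nZ only for prime n.                       *)
Definition primitive_root_mod (p g : int) : bool :=
  `|p|.-1%N.-primitive_root (g%:~R : 'F_(`|p|%N)).

(* Main.v *)
Require Import Defs.
From mathcomp Require Import all_boot all_order all_algebra.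
From mathcomp Require Import all_classical.
From mathcomp Require Import cyclic finfield.
From mathcomp Require Import ring zify.

(* Write p_n = 4 M (x + n^2) + d = 2^e q_n + 1 with M divisible by 24 g (2N)!.
   The 2N linear forms p_n and q_n in x satisfy the local conditions as soon as
   neither d nor (d - 1) / 2^e shares a prime factor with M, and then the tuplets
   conjecture makes them all prime for arbitrarily large x. The order of g modulo
   p_n = 2^e q_n + 1 divides 2^e q_n; it is p_n - 1 because g ^ (2^e) is not 1
   (p_n exceeds g^4 and |g| > 1) and because d is chosen so that g is a quadratic
   nonresidue modulo every prime congruent to d modulo M.
   To choose d, note that r is a quadratic residue, and -1 a nonresidue, modulo any
   prime p = -1 mod 8 r. Hence d = -1 mod M works for g < 0. For g > 0, perturb this
   choice at a single prime l with odd valuation in g: at l = 2 take d = 3 mod 8, at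
   l > 3 take d = -u with u a nonresidue other than -1. There remains g = 3 h^2,
   for which d = 5 mod 8 and e = 2. *)

Set Implicit Arguments.
Unset Strict Implicit.
Unset Printing Implicit Defensive.

Import Order.TTheory GRing.Theory Num.Theory.

Local Open Scope ring_scope.

(** * Cyclicity of the multiplicative group of a finite field *)

Lemma expf_card_pred (F : finFieldType) (x : F) : x != 0 -> x ^+ #|F|.-1 = 1.
Proof.
move=> x0; apply: (mulfI x0).
by rewrite mulr1 -exprS prednK ?expf_card //; apply/card_gt0P; exists x.
Qed.

(** The nonzero elements are #|F| - 1 roots of X ^ (#|F| - 1) - 1, so one of them generates the
    group; a suitable power of it has order n. *)
Lemma finField_prim_root (F : finFieldType) (n : nat) :
  (0 < n)%N -> (n %| #|F|.-1)%N -> exists z : F, n.-primitive_root z.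
Proof.
move=> n_gt0 nF; have F_gt0 : (0 < #|F|.-1)%N.
  by rewrite -ltnS prednK ?card_finNzRing_gt1 ?finNzRing_gt1 // ltnW ?finNzRing_gt1.
have /hasP[z _ zP] : has #|F|.-1.-primitive_root (enum (predC1 (0 : F))).
  apply: has_prim_root; rewrite ?enum_uniq //.
    by apply/allP=> x; rewrite mem_enum unity_rootE => /expf_card_pred->.
  by rewrite -cardE cardC1.
by exists (z ^+ (#|F|.-1 %/ n)); apply: dvdn_prim_root.
Qed.

(** * The Legendre symbol *)

(** Euler's criterion serves as the definition, [l./2] being (l - 1) / 2 for odd l. Integer values
    allow casts both to ['F_p] and to the field of a Gauss sum. *)
Definition legendre (l : nat) (x : 'F_l) : int :=
  if x == 0 then 0 else (-1) ^+ (x ^+ l./2 != 1).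

Section Legendre.
Variables (l : nat) (l_pr : prime l) (l_odd : odd l).

Lemma half_prime_gt0 : (0 < l./2)%N.
Proof. by have := prime_gt1 l_pr; move: l_odd; lia. Qed.

Lemma expFp_pred (x : 'F_l) : x != 0 -> x ^+ l.-1 = 1.
Proof. by move=> x0; rewrite -[RHS](expf_card_pred x0) card_Fp. Qed.

Lemma expFp_half (x : 'F_l) : x != 0 -> (x ^+ l./2 == 1) || (x ^+ l./2 == -1).
Proof.
move=> x0; rewrite -eqf_sqr expr1n -exprM -[X in _ == X](expFp_pred x0).
by apply/eqP; congr (_ ^+ _); move: l_odd; lia.
Qed.

Lemma oppFp1_neq1 : (-1 : 'F_l) != 1.
Proof.
rewrite eq_sym -subr_eq0 opprK -(natrD _ 1 1) -(dvdn_pcharf (pchar_Fp l_pr)).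
by apply/negP => /(@dvdn_leq _ 2 isT); have := half_prime_gt0; move: l_odd; lia.
Qed.

Lemma legendreM : {morph @legendre l : x y / x * y}.
Proof.
move=> x y; rewrite /legendre mulf_eq0.
have [->|x0] := eqVneq x 0; first by rewrite /= mul0r.
have [->|y0] := eqVneq y 0; first by rewrite /= mulr0.
rewrite /= exprMn.
have /orP[/eqP->|/eqP->] := expFp_half x0; have /orP[/eqP->|/eqP->] := expFp_half y0;
by rewrite ?mulr1 ?mul1r ?mulrNN ?mulr1 ?eqxx ?oppFp1_neq1.
Qed.

Lemma legendre_sqr (x : 'F_l) : x != 0 -> legendre x * legendre x = 1.
Proof. by move=> x0; rewrite /legendre (negPf x0) -signr_addb addbb. Qed.

(** A generator of the unit group is a nonresidue, since its order l - 1 does not divide [l./2]. *)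
Lemma legendre_nonresidue : exists2 u : 'F_l, u != 0 & legendre u = -1.
Proof.
have l1 : (0 < l.-1)%N by have := half_prime_gt0; lia.
have [u uP] : exists u : 'F_l, l.-1.-primitive_root u.
  by apply: finField_prim_root; rewrite ?card_Fp.
have u0 : u != 0.
  apply: contra_eq_neq (prim_expr_order uP) => ->.
  by rewrite expr0n eqn0Ngt l1 eq_sym oner_eq0.
exists u => //; rewrite /legendre (negPf u0) -(prim_order_dvd uP).
suff -> : (l.-1 %| l./2)%N = false by [].
by apply/negP => /(dvdn_leq half_prime_gt0); have := half_prime_gt0; move: l_odd; lia.
Qed.

Lemma legendre_nonresidueN1 : (3 < l)%N ->
  exists2 u : 'F_l, (u != 0) && (u != -1) & legendre u = -1.
Proof.
move=> l3; have [u u0 uN] := legendre_nonresidue.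
have [uE|uN1] := eqVneq u (-1); last by exists u; rewrite ?u0.
(* If u = -1 is the nonresidue found, then so is -4, and -4 <> -1 since l <> 3. *)
have nat_neq0 n : (0 < n < l)%N -> (n%:R : 'F_l) != 0.
  by case/andP=> n0 nl; rewrite -(dvdn_pcharf (pchar_Fp l_pr)) gtnNdvd.
have n2 : (2 : 'F_l) != 0 by apply: nat_neq0; lia.
have n3 : (3 : 'F_l) != 0 by apply: nat_neq0; lia.
exists (u * (2 * 2)); last by rewrite !legendreM legendre_sqr // uN.
rewrite !mulf_neq0 //= uE mulN1r eqr_opp -subr_eq0.
by rewrite (_ : 2 * 2 - 1 = 3) //; ring.
Qed.

(** Multiplication by a nonresidue permutes ['F_l] and changes the sign of the sum. *)
Lemma sum_legendre : \sum_(x : 'F_l) legendre x = 0.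
Proof.
have [u u0 uN] := legendre_nonresidue.
suff : \sum_(x : 'F_l) legendre x = - \sum_(x : 'F_l) legendre x by lia.
rewrite {1}(reindex_inj (mulfI u0)) -sumrN; apply: eq_bigr => x _.
by rewrite legendreM uN mulN1r.
Qed.

(** * Quadratic Gauss sums over a field with a primitive l-th root of unity *)

Section GaussSum.
Variables (F : fieldType) (z : F) (zP : l.-primitive_root z).

Let e (x : 'F_l) : F := z ^+ (x : nat).

Let e_nat n : e n%:R = z ^+ n.
Proof. by rewrite /e val_Fp_nat // prim_expr_mod. Qed.

Let eD x y : e (x + y) = e x * e y.
Proof. by rewrite -[x]natr_Zp -[y]natr_Zp -natrD !e_nat exprD. Qed.

Let e0 : e 0 = 1. Proof. exact: (e_nat 0). Qed.

(** Orthogonality of additive characters: shifting x by 1 multiplies the sum by [e a], which is not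
    1 when a is nonzero. *)
Let sum_e (a : 'F_l) : \sum_x e (x * a) = if a == 0 then l%:R else 0.
Proof.
case: eqP => [->|/eqP a0].
  under eq_bigr do rewrite mulr0 e0.
  by rewrite sumr_const card_Fp.
have : \sum_x e (x * a) = e a * \sum_x e (x * a).
  rewrite {1}(reindex_inj (addrI 1)) mulr_sumr; apply: eq_bigr => x _.
  by rewrite mulrDl mul1r eD.
move/eqP; rewrite -subr_eq0 -{1}[\sum_x _]mul1r -mulrBl mulf_eq0 => /orP[|/eqP //].
rewrite subr_eq0 eq_sym -(prim_order_dvd zP) => la; case/negP: a0.
by rewrite -[a]natr_Zp -(dvdn_pcharf (pchar_Fp l_pr)).
Qed.

Definition gauss_sum : F := \sum_(x : 'F_l) (legendre x)%:~R * e x.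

(** Substituting y = x u turns the square into a sum over u of the symbol of u times the sum of e (x
    (1 + u)) over nonzero x. The inner sum is l - 1 at u = -1 and -1 elsewhere; the terms -1 cancel
    because the symbols sum to 0. *)
Lemma gauss_sum_sqr : gauss_sum ^+ 2 = (legendre (-1 : 'F_l))%:~R * l%:R.
Proof.
have step (x : 'F_l) : (legendre x)%:~R * e x * gauss_sum =
    \sum_u (legendre u)%:~R * (if x == 0 then 0 else e (x * (1 + u))).
  have [->|x0] := eqVneq x 0.
    by rewrite /legendre eqxx !mul0r big1 // => u _; rewrite mulr0.
  rewrite /gauss_sum (reindex_inj (mulfI x0)) mulr_sumr; apply: eq_bigr => u _.
  rewrite legendreM intrM mulrDr mulr1 eD.
  rewrite [LHS](_ : _ = ((legendre x)%:~R * (legendre x)%:~R) *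
    ((legendre u)%:~R * (e x * e (x * u)))); last by ring.
  by rewrite -intrM legendre_sqr // mul1r.
rewrite expr2 {1}/gauss_sum mulr_suml.
under eq_bigr do rewrite step.
rewrite exchange_big /=.
have inner (u : 'F_l) : \sum_(x : 'F_l) (if x == 0 then 0 else e (x * (1 + u))) =
    (if u == -1 then l%:R else 0) - 1.
  apply: (addrI 1); rewrite addrCA subrr addr0 -addr_eq0 [u + 1]addrC -sum_e.
  rewrite (bigD1 0) //= add0r [RHS](bigD1 0) //= mul0r e0; congr (_ + _).
  by apply: eq_bigr => x /negPf->.
under eq_bigr do rewrite -mulr_sumr inner mulrBr mulr1.
rewrite sumrB -(rmorph_sum intr) sum_legendre subr0 (bigD1 (-1)) //= eqxx.
by rewrite big1 ?addr0 // => u /negPf->; rewrite mulr0.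
Qed.

(** Frobenius is additive, fixes integers and sends e x to e (p x); reindexing by p brings out the
    symbol of p. *)
Lemma gauss_sum_Frobenius (p : nat) : p \in [pchar F] -> (p%:R : 'F_l) != 0 ->
  gauss_sum ^+ p = (legendre (p%:R : 'F_l))%:~R * gauss_sum.
Proof.
move=> pF p0; rewrite -(pFrobenius_autE pF) /gauss_sum raddf_sum /=.
rewrite [in RHS](reindex_inj (mulfI p0)) mulr_sumr; apply: eq_bigr => x _.
rewrite rmorphM /= pFrobenius_aut_int pFrobenius_autE legendreM intrM !mulrA.
rewrite -intrM legendre_sqr // mul1r; congr (_ * _).
by rewrite -[x in RHS]natr_Zp -natrM e_nat /e -exprM mulnC.
Qed.

End GaussSum.

End Legendre.

(** * Quadratic reciprocity, with Euler powers modulo p *)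

Lemma intr_eq0_pchar (R : nzRingType) (p : nat) (a : int) : p \in [pchar R] ->
  (a%:~R == 0 :> R) = (p %| `|a|)%N.
Proof.
move=> pR; rewrite (dvdn_pcharf pR).
by case: a => n; rewrite ?NegzE ?mulrNz ?oppr_eq0 ?abszN.
Qed.

(** Both equalities say that p divides a - b. This carries identities between integers from an
    extension field down to ['F_p]. *)
Lemma eq_intr_pchar (R S : nzRingType) (p : nat) (a b : int) :
  p \in [pchar R] -> p \in [pchar S] -> (a%:~R == b%:~R :> R) = (a%:~R == b%:~R :> S).
Proof.
by move=> pR pS; rewrite -!(subr_eq0 _%:~R) -!intrB !(@intr_eq0_pchar _ p).
Qed.

(** In the field with p ^ totient n elements, n divides the order of the unit group by Euler's
    theorem. *)
Lemma pchar_prim_root (p n : nat) : prime p -> (0 < n)%N -> coprime p n ->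
  exists F : finFieldType, p \in [pchar F] /\ exists z : F, n.-primitive_root z.
Proof.
move=> p_pr n0 pn; have t0 : (0 < totient n)%N by rewrite totient_gt0.
have [F pF cF] := pPrimePowerField p_pr t0.
exists F; split=> //; apply: finField_prim_root => //.
rewrite cF -subn1 -eqn_mod_dvd ?expn_gt0 ?prime_gt0 //.
by apply/eqP/Euler_exp_totient.
Qed.

(** Multiplied by a Gauss sum tau in an extension of ['F_p], both sides equal tau ^ p: one through
    the value of tau ^ 2, the other by Frobenius. Here tau is nonzero because l is nonzero modulo
    p. *)
Lemma gauss_reciprocity (p l : nat) : prime p -> odd p -> prime l -> odd l ->
  p != l ->
  (legendre (-1 : 'F_l) * l%:Z)%:~R ^+ p./2 = (legendre (p%:R : 'F_l))%:~R :> 'F_p.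
Proof.
move=> p_pr p_odd l_pr l_odd pl.
have pl_co : coprime p l by rewrite prime_coprime // dvdn_prime2.
have [F [pF [z zP]]] := pchar_prim_root p_pr (prime_gt0 l_pr) pl_co.
apply/eqP; rewrite -rmorphXn /= (eq_intr_pchar _ _ (pchar_Fp p_pr) pF).
rewrite rmorphXn /= intrM -(gauss_sum_sqr l_pr l_odd zP).
have p0 : (p%:R : 'F_l) != 0.
  by rewrite -(dvdn_pcharf (pchar_Fp l_pr)) dvdn_prime2 // eq_sym.
have g0 : gauss_sum l z != 0.
  rewrite -sqrf_eq0 (gauss_sum_sqr l_pr l_odd zP) mulf_neq0 //.
    rewrite /legendre oppr_eq0 oner_eq0 rmorph_sign signr_eq0 //.
  by rewrite -(dvdn_pcharf pF) -prime_coprime.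
rewrite -exprM mul2n -(inj_eq (mulfI g0)) -exprS [X in X == _](_ : _ = gauss_sum l z ^+ p).
  by rewrite (gauss_sum_Frobenius l_pr l_odd zP pF p0) mulrC.
by congr (_ ^+ _); move: p_odd; lia.
Qed.

Lemma legendre2 (p : nat) : prime p -> (p %% 4 = 3)%N ->
  2 ^+ p./2 = (-1) ^+ (p %% 8 == 3)%N :> 'F_p.
Proof.
move=> p_pr p4; have p_odd : odd p by lia.
have p8 : coprime p 8 by rewrite (coprimeXr 3 (m := p) (n := 2)) // coprimen2.
have [F [pF [z zP]]] := pchar_prim_root p_pr (isT : 0 < 8)%N p8.
have z8 : z ^+ 8 = 1 := prim_expr_order zP.
have z4 : z ^+ 4 = -1.
  move/eqP: z8; rewrite (exprM z 4 2) sqrf_eq1 -(prim_order_dvd zP).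
  by case/orP=> // /eqP.
(* As z ^ 4 = -1, this is z + 1 / z, the classical square root of 2. *)
pose t := z - z ^+ 3.
have t2 : t ^+ 2 = 2.
  rewrite /t [LHS](_ : _ = z ^+ 2 * (1 + z ^+ 4) - 2 * z ^+ 4); last by ring.
  by rewrite z4; ring.
have tp : t ^+ p = (-1) ^+ (p %% 8 == 3)%N * t.
  rewrite -(pFrobenius_autE pF) rmorphB /= !pFrobenius_autE -exprM -(prim_expr_mod zP p).
  rewrite -(prim_expr_mod zP (3 * p)) -modnMmr.
  have [->|->] : (p %% 8 = 3 \/ p %% 8 = 7)%N by lia.
    by rewrite /t (_ : (3 * 3) %% 8 = 1)%N //=; ring.
  rewrite /t (_ : (3 * 7) %% 8 = 5)%N //= expr0 mul1r.
  by rewrite (exprD z 4 3) (exprD z 4 1) z4; ring.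
have t0 : t != 0.
  by rewrite -sqrf_eq0 t2 -(dvdn_pcharf pF); apply/negP => /(@dvdn_leq _ 2 isT); lia.
apply/eqP; have := eq_intr_pchar (2 ^+ p./2) ((-1) ^+ (p %% 8 == 3)%N) (pchar_Fp p_pr) pF.
rewrite !rmorph_sign !rmorphXn /= => ->.
rewrite -[2%:~R]t2 -exprM mul2n -(inj_eq (mulfI t0)) -exprS mulrC -tp.
by apply/eqP; congr (_ ^+ _); lia.
Qed.

Lemma legendre1 (l : nat) : legendre (1 : 'F_l) = 1.
Proof. by rewrite /legendre oner_eq0 expr1n eqxx. Qed.

(** Here [p./2] is odd, so the symbol of -1 survives and merges with that of p. *)
Lemma euler_reciprocity3 (p l : nat) : prime p -> (p %% 4 = 3)%N -> prime l -> odd l ->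
  p != l -> l%:R ^+ p./2 = (legendre (- p%:R : 'F_l))%:~R :> 'F_p.
Proof.
move=> p_pr p4 l_pr l_odd pl; have p_odd : odd p by lia.
have h_odd : odd p./2 by lia.
rewrite -mulN1r legendreM // intrM -(gauss_reciprocity p_pr p_odd l_pr l_odd pl).
rewrite intrM exprMn.
have sN : (legendre (-1 : 'F_l))%:~R ^+ p./2 = (legendre (-1 : 'F_l))%:~R :> 'F_p.
  rewrite /legendre oppr_eq0 oner_eq0 rmorph_sign; case: (_ != 1).
    by rewrite expr1 -signr_odd h_odd.
  by rewrite expr0 expr1n.
rewrite sN mulrA -intrM legendre_sqr ?mul1r //.
by rewrite oppr_eq0 oner_eq0.
Qed.

(** Here [p./2] is even, so the symbol of -1 disappears. *)
Lemma euler_reciprocity1 (p l : nat) : prime p -> (p %% 4 = 1)%N -> prime l -> odd l ->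
  p != l -> l%:R ^+ p./2 = (legendre (p%:R : 'F_l))%:~R :> 'F_p.
Proof.
move=> p_pr p4 l_pr l_odd pl; have p_odd : odd p by lia.
rewrite -(gauss_reciprocity p_pr p_odd l_pr l_odd pl) intrM exprMn.
rewrite /legendre oppr_eq0 oner_eq0 rmorph_sign; case: (_ != 1).
  by rewrite expr1 -signr_odd (_ : odd p./2 = false) ?mul1r //; lia.
by rewrite expr0 expr1n mul1r.
Qed.

(** By reciprocity the power is the symbol of -p modulo r, and -p is 1 there. *)
Lemma euler_prime_eq1 (p r : nat) : prime p -> (p %% 4 = 3)%N -> prime r -> odd r ->
  (r %| p.+1)%N -> r%:R ^+ p./2 = 1 :> 'F_p.
Proof.
move=> p_pr p4 r_pr r_odd rp; rewrite euler_reciprocity3 //; last first.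
  apply: contraTneq rp => ->.
  rewrite -addn1 dvdn_addr // dvdn1; have := prime_gt1 r_pr; lia.
suff -> : - p%:R = 1 :> 'F_r by rewrite legendre1.
apply/eqP; rewrite eq_sym -subr_eq0 opprK addrC natr1.
by rewrite -(dvdn_pcharf (pchar_Fp r_pr)).
Qed.

Lemma euler_nat_eq1 (p n : nat) : (0 < n)%N ->
  (forall r, prime r -> (r %| n)%N -> r%:R ^+ p./2 = 1 :> 'F_p) ->
  n%:R ^+ p./2 = 1 :> 'F_p.
Proof.
move=> n0 H; rewrite (prod_prime_decomp n0) natr_prod -prodrXl.
rewrite big1_seq // => -[r k] /= /mem_prime_decomp[r_pr k0 rn].
rewrite natrX exprAC H ?expr1n //; apply: dvdn_trans rn.
by rewrite -{1}[r]expn1 dvdn_exp2l.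
Qed.

Lemma even_logn_square (n : nat) : (0 < n)%N ->
  (forall l, prime l -> ~~ odd (logn l n)) -> exists h, n = (h ^ 2)%N.
Proof.
move=> n0 H; exists (\prod_(f <- prime_decomp n) f.1 ^ f.2./2)%N.
rewrite {1}(prod_prime_decomp n0) -mulnn -big_split; apply: eq_big_seq => -[r k] rk /=.
have [r_pr k0 rn] := mem_prime_decomp rk; rewrite -expnD addnn.
have := H r r_pr; suff -> : logn r n = k by move=> ?; congr (_ ^ _)%N; lia.
by move: rk; rewrite prime_decompE => /mapP[s _ [-> ->]].
Qed.

(** * Residue classes of primes modulo which g is a nonresidue *)

Lemma dvdn_partC (l M m : nat) : (0 < M)%N -> prime l -> coprime l m ->
  (m %| M)%N -> (m %| M`_l^')%N.
Proof.
move=> M0 l_pr lm; rewrite -{1}(partnC l M0) Gauss_dvdr // p_part.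
by rewrite coprimeXr // coprime_sym.
Qed.

Lemma eqmod_dvd (m M a b : nat) : (m %| M)%N -> a = b %[mod M] -> a = b %[mod m].
Proof. by move=> mM ab; rewrite -(modn_dvdm a mM) ab modn_dvdm. Qed.

Lemma eqmod_dvd_succ (m a b : nat) : a = b %[mod m] -> (m %| b.+1)%N -> (m %| a.+1)%N.
Proof. by move=> ab; rewrite /dvdn -addn1 -modnDml -ab modnDml addn1. Qed.

(** The class d is -1 modulo the prime-to-l part of M, hence modulo every divisor of M prime to
    l. *)
Lemma chinese_class (l M a : nat) : prime l -> (0 < M)%N ->
  exists d, d = a %[mod M`_l] /\
    forall m q, coprime l m -> (m %| M)%N -> q = d %[mod M] -> (m %| q.+1)%N.
Proof.
move=> l_pr M0; have co : coprime M`_l M`_l^' by apply: coprime_partC.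
exists (chinese M`_l M`_l^' a (M`_l^').-1).
split=> [|m q lm mM qd]; first by rewrite chinese_modl.
apply: eqmod_dvd_succ (eqmod_dvd mM qd) _.
apply: dvdn_trans (dvdn_partC M0 l_pr lm mM) _; rewrite /dvdn -addn1 -modnDml.
by rewrite chinese_modr // modnDml addn1 prednK ?part_gt0 // modnn.
Qed.

(** Modulo r > 2 the class -1 differs from 0 and 1, as the local conditions on p_n and q_n at r
    require. *)
Lemma dvdn_succ_avoid (r d : nat) : (2 < r)%N -> (r %| d.+1)%N ->
  ~~ (r %| d)%N /\ d != 1 %[mod r].
Proof.
move=> r2 rd; split.
  by apply/negP=> rd'; move: rd; rewrite -addn1 dvdn_addr // dvdn1; lia.
apply/eqP => d1; move: rd; rewrite /dvdn -addn1 -modnDml d1 modnDml modn_small //.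
Qed.

(* g is a nonresidue modulo the primes of the class d mod M; the congruence on d
   says that (d - 1) / 2 ^ e is odd. *)
Definition inert_class (M : nat) (g : int) (e d : nat) : Prop :=
  [/\ (0 < e <= 2)%N, d = 2 ^ e + 1 %[mod 2 ^ e.+1]%N,
      forall r, prime r -> odd r -> (r %| M)%N -> ~~ (r %| d)%N /\ d != 1 %[mod r]
    & forall p, prime p -> p = d %[mod M] -> g%:~R ^+ p./2 = -1 :> 'F_p].

Lemma odd_logn_dvdn (l n : nat) : odd (logn l n) -> (l %| n)%N.
Proof.
have [|] := posnP (logn l n); first by move->.
by rewrite logn_gt0 mem_primes => /and3P[].
Qed.

Section InertClass.
Variables (M : nat) (M_gt0 : (0 < M)%N) (M24 : (24 %| M)%N).

Let M8 : (8 %| M)%N. Proof. by apply: dvdn_trans M24. Qed.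
Let M3 : (3 %| M)%N. Proof. by apply: dvdn_trans M24. Qed.

Lemma euler_class_eq1 (p n : nat) : prime p -> (p %% 4 = 3)%N -> (0 < n)%N ->
  (forall r, prime r -> (r %| n)%N -> if r == 2%N then (p %% 8 = 7)%N else (r %| p.+1)%N) ->
  n%:R ^+ p./2 = 1 :> 'F_p.
Proof.
move=> p_pr p4 n0 H; apply: euler_nat_eq1 => // r r_pr rn; have := H r r_pr rn.
have [-> p8|r2] := eqVneq r 2%N; first by rewrite legendre2 // p8.
move=> rp; apply: euler_prime_eq1 => //.
by case: (even_prime r_pr) r2 => // ->.
Qed.

Lemma inert_class_neg (n : nat) : (0 < n)%N -> (n %| M)%N ->
  inert_class M (- n%:Z) 1%N M.-1.
Proof.
move=> n0 nM; split=> //; first by lia.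
  by move=> r r_pr r_odd rM; apply: dvdn_succ_avoid; rewrite ?prednK // odd_prime_gt2.
move=> p p_pr pM.
have Mp : (M %| p.+1)%N by apply: eqmod_dvd_succ pM _; rewrite prednK.
have p8 : (8 %| p.+1)%N by apply: dvdn_trans Mp.
rewrite rmorphN /= exprNn (@euler_class_eq1 p n) ?mulr1 //.
- by rewrite -signr_odd (_ : odd p./2 = true) //; lia.
- by lia.
move=> r r_pr rn; case: eqP => [_|_]; first by lia.
by apply: dvdn_trans rn (dvdn_trans nM Mp).
Qed.

Lemma neq_prime_coprime (r l : nat) : prime l -> prime r -> r != l -> coprime l r.
Proof. by move=> l_pr r_pr rl; rewrite prime_coprime // dvdn_prime2 // eq_sym. Qed.

Lemma partn_prime_factor (n l r : nat) : (0 < n)%N -> prime r -> (r %| n`_l^')%N ->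
  (r %| n)%N /\ r != l.
Proof.
move=> n0 r_pr rn; split; first by apply: dvdn_trans rn (dvdn_part _ _).
by have /pnatP := part_pnat l^' n => /(_ (part_gt0 _ _) r r_pr rn); rewrite !inE.
Qed.

(** Since p = 3 mod 8, the prime 2 is a nonresidue and occurs to an odd power, while the odd part of
    n stays a residue. *)
Lemma inert_class_two (n : nat) : (0 < n)%N -> (n %| M)%N -> odd (logn 2 n) ->
  exists d, inert_class M n 1%N d.
Proof.
move=> n0 nM n2; have [d [d2 succ]] := chinese_class 3 (isT : prime 2) M_gt0.
have M28 : (8 %| M`_2)%N by rewrite p_part (@dvdn_exp2l 2 3) // -pfactor_dvdn.
have d8 : d = 3 %[mod 8] by apply: eqmod_dvd d2.
exists d; split=> //; first by clear -d8; lia.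
  move=> r r_pr r_odd rM; apply: dvdn_succ_avoid; first exact: odd_prime_gt2.
  by apply: succ; rewrite ?coprime2n.
move=> p p_pr pd; have p8 : p = 3 %[mod 8] by rewrite (eqmod_dvd M8 pd).
rewrite -pmulrn -[in LHS](partnC 2%N n0) natrM exprMn.
rewrite (@euler_class_eq1 p n`_(2%N)^') //; first last.
- move=> r r_pr /(partn_prime_factor n0 r_pr)[rn r2]; rewrite (negPf r2).
  by apply: succ; rewrite // ?neq_prime_coprime // (dvdn_trans rn).
- by clear -p8; lia.
rewrite mulr1 p_part natrX exprAC legendre2 //; last by clear -p8; lia.
by rewrite p8 eqxx expr1 -signr_odd n2.
Qed.

(** By reciprocity the symbol of l modulo p is that of -p = u modulo l, namely -1. As u is neither 0
    nor -1, d is neither 0 nor 1 modulo l. *)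
Lemma inert_class_prime (n l : nat) : (0 < n)%N -> (n %| M)%N -> prime l -> (3 < l)%N ->
  odd (logn l n) -> exists d, inert_class M n 1%N d.
Proof.
move=> n0 nM l_pr l3 nl.
have l_odd : odd l by case: (even_prime l_pr) l3 => // ->.
have [u /andP[u0 uN1] uN] := legendre_nonresidueN1 l_pr l_odd l3.
have [d [dl succ]] := chinese_class (- u)%R l_pr M_gt0.
have lM : (l %| M)%N by apply: dvdn_trans (odd_logn_dvdn nl) nM.
have lMl : (l %| M`_l)%N by rewrite p_part dvdn_exp // logn_gt0 mem_primes l_pr M_gt0.
have d_l : d%:R = - u :> 'F_l.
  rewrite -(Fp_nat_mod l_pr) (eqmod_dvd lMl dl) Fp_nat_mod //.
  exact: natr_Zp.
have l8 : coprime l 8 by rewrite (@coprimeXr 3 l 2) ?coprimen2.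
have d8 : (8 %| d.+1)%N by apply: succ.
exists d; split=> //; first by clear -d8; lia.
  move=> r r_pr r_odd rM; have [->|rl] := eqVneq r l.
    split; first by rewrite (dvdn_pcharf (pchar_Fp l_pr)) d_l oppr_eq0.
    apply: contra_neq uN1 => d1; apply: oppr_inj; rewrite opprK -d_l.
    by rewrite -(Fp_nat_mod l_pr) d1 Fp_nat_mod.
  apply: dvdn_succ_avoid; first exact: odd_prime_gt2.
  by apply: succ; rewrite ?neq_prime_coprime.
move=> p p_pr pd; have p8 : (8 %| p.+1)%N by apply: succ.
have p_l : p%:R = - u :> 'F_l.
  by rewrite -(Fp_nat_mod l_pr) (eqmod_dvd lM pd) Fp_nat_mod.
rewrite -pmulrn -[in LHS](partnC l n0) natrM exprMn.
rewrite (@euler_class_eq1 p n`_l^') //; first last.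
- move=> r r_pr /(partn_prime_factor n0 r_pr)[rn rl].
  case: eqP => _; first by clear -p8; lia.
  by apply: succ; rewrite // ?neq_prime_coprime // (dvdn_trans rn).
- by clear -p8; lia.
rewrite mulr1 p_part natrX exprAC euler_reciprocity3 //; first last.
- apply: contraNneq u0 => pl; rewrite -oppr_eq0 -p_l pl.
  by rewrite -(dvdn_pcharf (pchar_Fp l_pr)).
- by clear -p8; lia.
by rewrite p_l opprK uN rmorphN1 -signr_odd nl.
Qed.

(** Modulo 3 the only nonresidue is -1, and u = -1 would give d = 1 mod 3. Taking p = 1 mod 4
    instead, the symbol of 3 modulo p is that of p = 2 modulo 3, which is -1. Now d - 1 = 4 mod 8,
    whence e = 2. *)
Lemma inert_class_three (h : nat) : (0 < h)%N -> (h %| M)%N ->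
  exists d, inert_class M (3 * h ^ 2)%N 2%N d.
Proof.
move=> h0 hM; have [d [d2 succ]] := chinese_class 5 (isT : prime 2) M_gt0.
have M28 : (8 %| M`_2)%N by rewrite p_part (@dvdn_exp2l 2 3) // -pfactor_dvdn.
have d8 : d = 5 %[mod 8] by apply: eqmod_dvd d2.
have avoid r : prime r -> odd r -> (r %| M)%N -> ~~ (r %| d)%N /\ d != 1 %[mod r].
  move=> r_pr r_odd rM; apply: dvdn_succ_avoid; first exact: odd_prime_gt2.
  by apply: succ; rewrite ?coprime2n.
exists d; split=> //.
move=> p p_pr pd; have p8 : p = 5 %[mod 8] by rewrite (eqmod_dvd M8 pd).
have p3 : (3 %| p.+1)%N by apply: succ.
have p_odd : odd p by clear -p8; lia.
(* Otherwise p, being congruent to d modulo M, would divide d. *)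
have pM : ~~ (p %| M)%N.
  apply/negP=> pM; have [/negP[]] := avoid p p_pr p_odd pM.
  by have := eqmod_dvd pM pd; rewrite /dvdn => <-; rewrite modnn.
have h_p : h%:R != 0 :> 'F_p.
  rewrite -(dvdn_pcharf (pchar_Fp p_pr)); apply: contra pM => /dvdn_trans; exact.
rewrite -pmulrn natrM natrX exprMn -exprM.
rewrite (_ : (2 * p./2)%N = p.-1) ?expFp_pred ?mulr1 //; last by clear -p_odd; lia.
rewrite euler_reciprocity1 //; [|by clear -p8; lia|by apply: contraTneq p3 => ->].
rewrite -(Fp_nat_mod (isT : prime 3)) (_ : p %% 3 = 2)%N //; clear -p3; lia.
Qed.

Lemma exists_inert_class (g : int) : (`|g| %| M)%N -> ~ (exists h : int, g = h ^+ 2) ->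
  exists e d, inert_class M g e d.
Proof.
move=> gM gsq; have g0 : g != 0 by apply/eqP => g0; case: gsq; exists 0.
have n0 : (0 < `|g|)%N by rewrite absz_gt0.
have [g_neg|g_pos] := ltrP g 0.
  exists 1%N, M.-1; have -> : g = - `|g|%N%:Z by lia.
  exact: inert_class_neg.
have nsq : ~ exists h, `|g|%N = (h ^ 2)%N.
  by case=> h gh; apply: gsq; exists h%:Z; rewrite -[g]gez0_abs // gh -mulnn PoszM expr2.
have gE : g = `|g|%N by lia.
rewrite gE; move: (`|g|%N) n0 gM nsq => n n0 nM nsq {g g0 gE g_pos gsq}.
have [n2|n2] := boolP (odd (logn 2 n)).
  by exists 1%N; apply: inert_class_two.
have [/hasP[l]|/hasPn nl] := boolP (has (fun l => (3 < l)%N && odd (logn l n)) (primes n)).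
  rewrite mem_primes => /andP[l_pr _] /andP[l3 nl].
  by exists 1%N; apply: inert_class_prime nl.
(* Only 3 can still occur to an odd power, and it does since n is not a square. *)
have n_even l : prime l -> l != 3%N -> ~~ odd (logn l n).
  move=> l_pr l3; have [->//|l2] := eqVneq l 2.
  have [ln|] := boolP (l \in primes n); last by rewrite -logn_gt0; case: logn.
  have := nl l ln; have := prime_gt1 l_pr; rewrite negb_and -leqNgt => l1 /orP[|//].
  by move/eqP: l3; move/eqP: l2; lia.
have [n3|n3] := boolP (odd (logn 3 n)); last first.
  case: nsq; apply: even_logn_square => // l l_pr.
  by have [->|/n_even->] := eqVneq l 3%N.
have dvd3 := odd_logn_dvdn n3.
have [h hE] : exists h, (n %/ 3 = h ^ 2)%N.
  apply: even_logn_square; first by rewrite divn_gt0 // dvdn_leq.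
  move=> l l_pr; rewrite logn_div //; have [->|l3] := eqVneq l 3%N.
    by rewrite (@logn_prime 3 3) // oddB ?n3 // logn_gt0 mem_primes n0.
  by rewrite (@logn_prime l 3) // (negPf l3) subn0 n_even.
have nE : n = (3 * h ^ 2)%N by rewrite -hE mulnC divnK.
exists 2%N; rewrite nE; apply: inert_class_three.
  by move: n0; rewrite nE; case: (h).
by apply: dvdn_trans nM; rewrite nE dvdn_mull // dvdn_exp.
Qed.

End InertClass.

(** * Consequences of the tuplets conjecture *)

(** Positivity of a single form bounds the solutions from below, so an infinite set of them is
    unbounded above. *)
Lemma prime_tuplets_large (k : nat) (A B : 'I_k -> nat) : (0 < k)%N ->
  prime_tuplets_conjecture k -> (forall j, 0 < A j)%N ->
  (forall l, prime l -> exists x : nat, forall j, ~~ (l %| A j * x + B j)%N) ->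
  forall K : nat, exists2 x : nat, (K < x)%N & forall j, prime (A j * x + B j)%N.
Proof.
move=> k0 TC A0 AB K; have j0 : 'I_k := Ordinal k0.
have := TC (fun j => A j) (fun j => B j) (fun j => A0 j).
have adm p : prime p ->
    exists x : int, ~~ (p%:Z %| \prod_(j < k) ((A j)%:Z * x + (B j)%:Z))%Z.
  move=> p_pr; have [x xP] := AB p p_pr; exists x%:Z.
  have -> : \prod_(j < k) ((A j)%:Z * x%:Z + (B j)%:Z) = (\prod_(j < k) (A j * x + B j))%N.
    by rewrite (big_morph Posz PoszM (erefl _)).
  by rewrite dvdzE !absz_nat Euclid_dvd_prod // big_orE; apply/existsPn => j; apply: xP.
move=> /(_ adm) infS; apply: contrapT => noX; apply: infS.
pose m := maxn (B j0) K.
(* The shifted initial segment is the interval from -m to m. *)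
apply: (@sub_finite_set _ _ [set i%:Z - m%:Z | i in `I_(m.*2.+1)]%classic).
  move=> x /= xS; have x_ge : - m%:Z <= x.
    have /andP[] := xS j0; have := A0 j0; rewrite /m; nia.
  have [mx|xm] := ltrP m%:Z x; last first.
    by exists (absz (x + m%:Z)%R) => /=; lia.
  case: noX; exists `|x|%N; first by rewrite /m in mx; lia.
  move=> j; have /andP[_] := xS j; congr (is_true (prime _)).
  have -> : x = `|x|%N by lia.
  by rewrite -PoszM -PoszD !absz_nat.
by apply/finite_image/finite_II.
Qed.

(** At a prime dividing a and a' the value x = 0 works, as d and d' are prime to it. At any other
    prime l each of the 2N forms vanishes for one residue of x only, and 2N < l leaves a residue
    free. *)
Lemma prime_tuplets_quadratic (N a a' d d' : nat) : (0 < N)%N ->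
  prime_tuplets_conjecture (2 * N) -> (0 < a)%N -> (0 < a')%N ->
  (forall l, prime l ->
     [&& l %| a, l %| a', ~~ (l %| d) & ~~ (l %| d')]%N \/
     [&& ~~ (l %| a), ~~ (l %| a') & 2 * N < l]%N) ->
  forall K : nat, exists2 x : nat, (K < x)%N &
    forall n : nat, (1 <= n <= N)%N ->
      prime (a * (x + n ^ 2) + d)%N /\ prime (a' * (x + n ^ 2) + d')%N.
Proof.
move=> N0 TC a0 a'0 H K.
(* Odd j carries the form with a and d, even j the one with a' and d', both for n = [j./2.+1]. *)
pose A (j : 'I_(2 * N)) := if odd j then a else a'.
pose B (j : 'I_(2 * N)) :=
  if odd j then (a * j./2.+1 ^ 2 + d)%N else (a' * j./2.+1 ^ 2 + d')%N.
have [||l l_pr|x Kx xP] := @prime_tuplets_large (2 * N) A B _ TC _ _ K.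
- by lia.
- by move=> j; rewrite /A; case: ifP.
- have [/and4P[la la' ld ld']|/and3P[la la' lN]] := H l l_pr.
    exists 0%N => j; rewrite /A /B; case: ifP => _;
    by rewrite muln0 add0n dvdn_addr // dvdn_mulr.
  pose f (j : 'I_(2 * N)) : 'F_l := - (B j)%:R / (A j)%:R.
  have [y yf] : exists y, y \notin codom f.
    apply/existsP; rewrite -negb_forall; apply: contraL lN => /forallP fy.
    rewrite -leqNgt -[l in (l <= _)%N](card_Fp l_pr) -(card_ord (2 * N)).
    rewrite -(size_codom f) (_ : #|'F_l| = #|codom f|) ?card_size //.
    by apply/esym/eq_card => y; rewrite fy.
  exists (y : nat) => j; apply: contra yf; rewrite (dvdn_pcharf (pchar_Fp l_pr)).
  rewrite natrD natrM natr_Zp addr_eq0 => /eqP Ay; apply/codomP; exists j.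
  rewrite /f -Ay mulrAC divff ?mul1r // -(dvdn_pcharf (pchar_Fp l_pr)).
  by rewrite /A; case: ifP.
exists x => // n /andP[n1 nN].
have i1 : (n.-1.*2.+1 < 2 * N)%N by lia.
have i2 : (n.-1.*2 < 2 * N)%N by lia.
have := xP (Ordinal i1); have := xP (Ordinal i2); rewrite /A /B /= odd_double /=.
by rewrite uphalf_double doubleK prednK // !mulnDr !addnA.
Qed.

(** * Primitive roots modulo p = 2^e q + 1, and the conclusion *)

(** The order m of x divides 2^e q but not 2^e, so q divides m. Then m / q divides 2^e but not 2^(e
    - 1), so it is 2^e. *)
Lemma primitive_root_criterion (p q e : nat) (x : 'F_p) : prime p -> prime q ->
  (0 < e)%N -> p = (2 ^ e * q).+1 -> x ^+ p./2 = -1 -> x ^+ (2 ^ e)%N != 1 ->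
  p.-1.-primitive_root x.
Proof.
move=> p_pr q_pr e0 pE xh xe.
have e2 : (2 ^ e = 2 * 2 ^ e.-1)%N by rewrite -expnS prednK.
have hE : (p./2 = 2 ^ e.-1 * q)%N by rewrite pE e2; lia.
have p_odd : odd p by rewrite pE e2 /= -mulnA mul2n odd_double.
have x0 : x != 0.
  apply: contra_eq_neq xh => ->; rewrite expr0n gtn_eqF.
    by rewrite eq_sym oppr_eq0 oner_eq0.
  by rewrite hE muln_gt0 expn_gt0 (prime_gt0 q_pr).
have p1E : p.-1 = (2 ^ e * q)%N by rewrite pE.
have p1 : (0 < p.-1)%N by rewrite p1E muln_gt0 expn_gt0 (prime_gt0 q_pr).
have [m mP] := prim_order_exists p1 (expFp_pred p_pr x0).
move=> m_dvd; rewrite p1E in m_dvd.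
have m_e : ~~ (m %| 2 ^ e)%N by rewrite (prim_order_dvd mP).
have m_h : ~~ (m %| 2 ^ e.-1 * q)%N.
  by rewrite -hE (prim_order_dvd mP) xh oppFp1_neq1.
have qm : (q %| m)%N.
  apply: contraR m_e => qm; rewrite -(@Gauss_dvdl _ _ q) //.
  by rewrite coprime_sym prime_coprime.
have /dvdnP[m' m'E] := qm.
rewrite {1}m'E dvdn_pmul2r ?prime_gt0 // in m_dvd.
rewrite m'E dvdn_pmul2r ?prime_gt0 // in m_h.
have /(dvdn_pfactor _ _ (isT : prime 2))[k ke m'k] := m_dvd.
rewrite m'k dvdn_Pexp2l // -ltnNge prednK // in m_h.
have k_e : k = e by lia.
by rewrite (_ : p.-1 = m) // m'E m'k k_e -p1E.
Qed.

Theorem theorem2 (N : nat) (hN : (1 <= N)%N)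
    (hTC : prime_tuplets_conjecture (2 * N))
    (g : int) (hg1 : g <> -1) (hg2 : ~ (exists h : int, g = h ^+ 2)) :
  exists A1 C1 : int, forall n : nat, (1 <= n <= N)%N ->
    primez (A1 * n%:Z ^+ 2 + C1) /\
    primitive_root_mod (A1 * n%:Z ^+ 2 + C1) g.
Proof.
have g0 : (0 < `|g|)%N.
  by rewrite absz_gt0; apply/eqP => g0; apply: hg2; exists 0.
have g1 : (1 < `|g|)%N.
  have : g <> 1 by move=> g1; apply: hg2; exists 1.
  by move: g0 hg1; lia.
(* The factor 24 serves the congruences modulo 8 and 3, the factorial makes every prime not dividing
   M exceed 2N, and |g| lets the class modulo M decide the quadratic character of g. *)
pose M := (24 * ((2 * N)`! * `|g|))%N.
have M0 : (0 < M)%N by rewrite /M !muln_gt0 fact_gt0 g0.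
have M24 : (24 %| M)%N by rewrite dvdn_mulr.
have gM : (`|g| %| M)%N by rewrite !dvdn_mull.
have [e [d [e12 de dM gp]]] := exists_inert_class M0 M24 gM hg2.
(* Oddness of d' is the local condition on q_n at 2. *)
have [d' dE d'_odd] : exists2 d', d = (2 ^ e * d').+1 & odd d'.
  case/andP: e12; case: e de {gp} => [|[|[|]]] // de _ _.
    by exists (d %/ 2)%N; lia.
  by exists (d %/ 4)%N; lia.
(* This is 4 M / 2^e, the leading coefficient of q_n, for e = 1 and e = 2 alike. *)
pose a' := (M * 2 ^ (2 - e))%N.
have aE : (M * 4 = 2 ^ e * a')%N.
  by rewrite /a' mulnCA -expnD subnKC //; case/andP: e12.
have adm l : prime l ->
     [&& l %| M * 4, l %| a', ~~ (l %| d) & ~~ (l %| d')]%N \/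
     [&& ~~ (l %| M * 4), ~~ (l %| a') & 2 * N < l]%N.
  move=> l_pr; have [lM|lM] := boolP (l %| M)%N.
    left; rewrite (dvdn_mulr 4 lM) (dvdn_mulr (2 ^ (2 - e)) lM : l %| a')%N /=.
    have [->|l2] := eqVneq l 2%N.
      rewrite !dvdn2 d'_odd dE /= oddM oddX; case/andP: e12.
      by case: (e).
    have l_odd : odd l by case: (even_prime l_pr) l2 => // ->.
    have [ld ld1] := dM l l_pr l_odd lM; rewrite ld /=.
    by apply: contra ld1 => ld'; rewrite dE -addn1 -modnDml (eqP (dvdn_mull _ ld')).
  right; have l2 : ~~ (l %| 2)%N.
    by apply: contra lM => /dvdn_trans; apply; apply: dvdn_trans M24.
  have l2k k : ~~ (l %| 2 ^ k)%N by rewrite Euclid_dvdX // (negPf l2).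
  rewrite (Euclid_dvdM M 4 l_pr) (Euclid_dvdM M _ l_pr) !negb_or lM.
  rewrite (l2k 2) (l2k (2 - e)%N) /= ltnNge; apply: contra lM => lN.
  by rewrite dvdn_mull // dvdn_mulr // dvdn_fact // prime_gt0.
have [||x gx xP] := prime_tuplets_quadratic hN hTC _ _ adm (`|g| ^ 4)%N.
- by rewrite muln_gt0 M0.
- by rewrite muln_gt0 M0 expn_gt0.
exists (M * 4)%N%:Z, (M * 4 * x + d)%N%:Z => n nN.
have [p_pr q_pr] := xP n nN.
pose p := (M * 4 * (x + n ^ 2) + d)%N; pose q := (a' * (x + n ^ 2) + d')%N.
have -> : (M * 4)%N%:Z * n%:Z ^+ 2 + (M * 4 * x + d)%N%:Z = p%:Z.
  by rewrite /p -rmorphXn -!PoszM -!PoszD; congr Posz; lia.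
split; first by rewrite /primez absz_nat p_pr andbT ltz_nat prime_gt0.
rewrite /primitive_root_mod absz_nat.
have pE : p = (2 ^ e * q).+1 by rewrite /p /q aE dE; lia.
have pd : p = d %[mod M] by rewrite /p -mulnA mulnC modnMDl.
apply: (primitive_root_criterion p_pr q_pr _ pE (gp p p_pr pd)).
  by case/andP: e12.
have p_large : (`|g| ^ 4 < p)%N.
  apply: leq_trans gx (leq_trans (leq_addr (n ^ 2) x) _).
  by apply: leq_trans (leq_addr d _); rewrite leq_pmull // muln_gt0 M0.
(* As 2^e divides 4, g ^ (2^e) = 1 would give g ^ 4 = 1 modulo p; but g ^ 4 - 1 lies strictly
   between 0 and p. *)
apply/negP => ge1.
have g4 : (g ^+ 4)%:~R == 1%:~R :> 'F_p.
  rewrite rmorphXn /= (_ : 4 = 2 ^ e * 2 ^ (2 - e))%N; last first.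
    by rewrite -expnD subnKC //; case/andP: e12.
  by rewrite exprM (eqP ge1) expr1n.
have abs4 : `|g ^+ 4 - 1|%N = (`|g| ^ 4).-1.
  have -> : g ^+ 4 = (`|g| ^ 4)%N%:Z by rewrite -abszX gez0_abs // (exprM g 2 2) sqr_ge0.
  by rewrite subzn ?expn_gt0 ?g0 // absz_nat subn1.
move: g4; rewrite -subr_eq0 -intrB (intr_eq0_pchar _ (pchar_Fp p_pr)) abs4.
have g4 : (1 < `|g| ^ 4)%N by rewrite (ltn_exp2l 0).
by rewrite gtnNdvd // -ltnS prednK // ltnW // ltnW.
Qed.
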